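(* Let $\Gamma$ be a connected strongly regular graph. Then $\Gamma$ admits perfect state transfer (for the Grover walk) if and only if $\Gamma$ is isomorphic to the complete bipartite graph $K_{2,2}$ or to the complete tripartite graph $K_{2,2,2}$.
   Context: Graphs are finite and simple, with every vertex of positive degree. A graph $\Gamma=(V,E)$ on $n$ vertices is strongly regular with parameters $(n,k,\lambda,\mu)$ if it is neither complete nor edgeless, it is $k$-regular, any two adjacent vertices have exactly $\lambda$ common neighbours, and any two distinct non-adjacent vertices have exactly $\mu$ common neighbours. Grover walk: let $\mathcal{A}=\{(x,y),(y,x)\mid \{x,y\}\in E\}$ be the set of arcs; for $a=(x,y)$ write $o(a)=x$, $t(a)=y$, $a^{-1}=(y,x)$. The boundary matrix $d\in\mathbb{C}^{V\times\mathcal{A}}$ is $d_{x,a}=\frac{1}{\sqrt{\deg x}}\delta_{x,t(a)}$, the shift matrix $R\in\mathbb{C}^{\mathcal{A}\times\mathcal{A}}$ is $R_{a,b}=\delta_{a,b^{-1}}$, and the time evolution matrix is $U=R(2d^*d-I)$. For $x\in V$ let $e_x\in\mathbb{C}^V$ be the standard unit vector. For distinct unit vectors $\Phi,\Psi\in\mathbb{C}^{\mathcal{A}}$, perfect state transfer occurs from $\Phi$ to $\Psi$ at time $\tau\in\mathbb{Z}_{\ge1}$ if $U^\tau\Phi=\gamma\Psi$ for some $\gamma\in\mathbb{C}$ with $|\gamma|=1$. The graph $\Gamma$ admits perfect state transfer if perfect state transfer occurs from $d^*e_x$ to $d^*e_y$ at some time $\tau\ge1$ for some pair of distinct vertices $x\neq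 y$. *)

(* Defs.v *)
From HB Require Import structures.
From mathcomp Require Import all_boot all_order all_algebra.
From mathcomp Require Import complex reals.

Set Implicit Arguments.
Unset Strict Implicit.
Unset Printing Implicit Defensive.

Import Order.TTheory GRing.Theory Num.Theory.

Local Open Scope ring_scope.

Section Graphs.
Variable V : finType.
Implicit Types (e : rel V) (x y : V).

Definition degree e x : nat := #|[set y | e x y]|.

Definition common_neighbours e x y : {set V} := [set z | e x z && e y z].

Definition simple_graph e : Prop :=
  [/\ symmetric e, irreflexive e & forall x, (0 < degree e x)%N].

Definition connected_graph e : Prop := forall x y, connect e x y.

Definition complete_graph e : Prop := forall x y, x != y -> e x y.

Definition edgeless_graph e : Prop := forall x y, ~~ e x y.

Definition srg e (n k l m : nat) : Prop :=
  [/\ #|V| = n, ~ complete_graph e & ~ edgeless_graph e] /\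
  [/\ forall x, degree e x = k,
      forall x y, e x y -> #|common_neighbours e x y| = l &
      forall x y, x != y -> ~~ e x y -> #|common_neighbours e x y| = m].

Definition strongly_regular e : Prop := exists n k l m : nat, srg e n k l m.

End Graphs.

Definition graph_iso (V W : finType) (e : rel V) (e' : rel W) : Prop :=
  exists2 f : V -> W, bijective f & forall x y, e' (f x) (f y) = e x y.

(* The vertices of K_(s_0, s_1, ...) are the pairs of a part i and a j < s_i. *)
Definition multipartite_vertex (s : seq nat) : finType :=
  {i : 'I_(size s) & 'I_(nth 0%N s i)}.

Definition complete_multipartite (s : seq nat) : rel (multipartite_vertex s) :=
  fun u v => tag u != tag v.

Definition arc (V : finType) (e : rel V) : finType := {a : V * V | e a.1 a.2}.

Section GroverWalk.
Variables (C : numClosedFieldType) (V : finType) (e : rel V).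

Definition origin (a : arc e) : V := (val a).1.
Definition terminus (a : arc e) : V := (val a).2.

(* Rows and columns are indexed by V and by the arcs through enum_val. *)
Definition boundary_mx : 'M[C]_(#|V|, #|arc e|) :=
  \matrix_(i, j) ((sqrtC (degree e (enum_val i))%:R)^-1
                  * (enum_val i == terminus (enum_val j))%:R).

(* The condition says that the arc a is the inverse of the arc b. *)
Definition shift_mx : 'M[C]_#|arc e| :=
  \matrix_(i, j) (let a : arc e := enum_val i in let b : arc e := enum_val j in
    ((origin a == terminus b) && (terminus a == origin b))%:R).

Definition adjoint_mx (p q : nat) (A : 'M[C]_(p, q)) : 'M[C]_(q, p) :=
  map_mx Num.conj A^T.

Definition evolution_mx : 'M[C]_#|arc e| :=
  shift_mx *m (2%:R *: (adjoint_mx boundary_mx *m boundary_mx) - 1%:M).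

Definition unit_vector (p : nat) (v : 'cV[C]_p) : Prop :=
  \sum_i `|v i 0| ^+ 2 = 1.

Definition perfect_state_transfer (Phi Psi : 'cV[C]_#|arc e|) (tau : nat) :
    Prop :=
  [/\ unit_vector Phi, unit_vector Psi, Phi <> Psi, (0 < tau)%N &
      exists2 g : C, `|g| = 1 & evolution_mx ^+ tau *m Phi = g *: Psi].

Definition vertex_state (x : V) : 'cV[C]_#|arc e| :=
  adjoint_mx boundary_mx *m delta_mx (enum_rank x) 0.

Definition admits_pst : Prop :=
  exists x y : V, x != y /\
    exists tau : nat,
      perfect_state_transfer (vertex_state x) (vertex_state y) tau.

End GroverWalk.

Arguments admits_pst C {V} e.

(* Main.v *)
(* Let P = A / k and X_n = d U^n d^*. Since the shift and the coin 2 d^* d - 1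
   are involutions, X_(n+2) = 2 P X_(n+1) - X_n, so X_n = T_n(P) for the
   Chebyshev polynomial T_n; and as U is unitary, transfer from d^* e_x to d^*
   e_y at time n amounts to X_n e_x = g e_y. For a strongly regular graph X_n
   is in the span of 1, A and J, which forces y to be the only non-neighbour
   of x: the graph is K_(2,...,2), with k = |V| - 2. The difference of two
   antipodal pairs is then an eigenvector of P for - 2 / k on which X_n must
   act as 1, so T_n(- 2 / k) = 1; hence - 4 / k is a root of a monic integer
   polynomial and k divides 4. Conversely A^2 = k J - 2 A gives X_2 = J - 1 -
   A when k = 2 and X_6 = J - 1 - A when k = 4. *)
Require Import Defs.
From mathcomp Require Import all_boot all_order all_algebra.
From mathcomp Require Import complex reals.
From mathcomp Require Import ring.

Set Implicit Arguments.
Unset Strict Implicit.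
Unset Printing Implicit Defensive.

Import Order.TTheory GRing.Theory Num.Theory.

Local Open Scope ring_scope.

(* [path.arc] shadows the type of arcs. *)
Local Notation arc := Defs.arc.

(** * Adjoints and norms of complex matrices *)

Section AdjointMatrix.
Variable C : numClosedFieldType.

Lemma adjoint_mxM p q r (A : 'M[C]_(p, q)) (B : 'M[C]_(q, r)) :
  adjoint_mx (A *m B) = adjoint_mx B *m adjoint_mx A.
Proof. by rewrite /adjoint_mx trmx_mul map_mxM. Qed.

Lemma adjoint_mxK p q (A : 'M[C]_(p, q)) : adjoint_mx (adjoint_mx A) = A.
Proof. by apply/matrixP=> i j; rewrite !mxE conjCK. Qed.

Lemma adjoint_mxB p q (A B : 'M[C]_(p, q)) :
  adjoint_mx (A - B) = adjoint_mx A - adjoint_mx B.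
Proof. by apply/matrixP=> i j; rewrite !mxE rmorphB. Qed.

Lemma adjoint_mx_delta p q (i : 'I_p) (j : 'I_q) :
  adjoint_mx (delta_mx i j : 'M[C]_(p, q)) = delta_mx j i.
Proof. by apply/matrixP=> a b; rewrite !mxE conjC_nat andbC. Qed.

Lemma adjoint_mx1 p : adjoint_mx (1%:M : 'M[C]_p) = 1%:M.
Proof. by apply/matrixP=> a b; rewrite !mxE conjC_nat eq_sym. Qed.

Lemma adjoint_mxZ_nat p q k (A : 'M[C]_(p, q)) :
  adjoint_mx (k%:R *: A) = k%:R *: adjoint_mx A.
Proof. by apply/matrixP=> i j; rewrite !mxE rmorphM /= conjC_nat. Qed.

Lemma adjoint_mulmx_norm p (v : 'cV[C]_p) :
  (adjoint_mx v *m v) 0 0 = \sum_i `|v i 0| ^+ 2.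
Proof. by rewrite mxE; apply: eq_bigr => i _; rewrite !mxE normCKC. Qed.

(** The product is a sum of squared moduli, all of which must vanish. This serves to prove two
    states equal by computing inner products. *)
Lemma adjoint_mulmx_eq0 p (v : 'cV[C]_p) : adjoint_mx v *m v = 0 -> v = 0.
Proof.
move=> v0; apply/matrixP=> i j; rewrite ord1 mxE.
have /(congr1 (fun A : 'M_1 => A 0 0)) := v0.
rewrite adjoint_mulmx_norm mxE => /psumr_eq0P s0.
have /eqP := s0 (fun i _ => exprn_ge0 2 (normr_ge0 _)) i isT.
by rewrite sqrf_eq0 normr_eq0 => /eqP.
Qed.

Lemma unit_vectorP p (v : 'cV[C]_p) :
  unit_vector v <-> adjoint_mx v *m v = 1%:M.
Proof.
rewrite /unit_vector -adjoint_mulmx_norm;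
  split=> [v1 | ->]; last by rewrite mxE.
by rewrite [LHS]mx11_scalar v1.
Qed.

End AdjointMatrix.

(** * The Grover walk compressed to the vertex space *)

Section GroverWalkSpectrum.
Variables (C : numClosedFieldType) (V : finType) (e : rel V).
Hypotheses (sym_e : symmetric e) (deg_gt0 : forall x, (0 < degree e x)%N).

Local Notation d := (boundary_mx C e).
Local Notation dh := (adjoint_mx d).
Local Notation S := (shift_mx C e).
Local Notation U := (evolution_mx C e).

Lemma arc_rev_proof (a : arc e) :
  e (terminus a, origin a).1 (terminus a, origin a).2.
Proof. by rewrite /= sym_e; exact: (valP a). Qed.

Definition arc_rev (a : arc e) : arc e := Sub _ (arc_rev_proof a).

Lemma shift_mulmx p (A : 'M[C]_(_, p)) i j :
  (S *m A) i j = A (enum_rank (arc_rev (enum_val i))) j.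
Proof.
rewrite mxE (bigD1 (enum_rank (arc_rev (enum_val i)))) //= big1 ?addr0.
  by rewrite mxE enum_rankK /origin /terminus /= !eqxx mul1r.
move=> l ne_l; rewrite mxE /=; case: andP => [[/eqP o /eqP t]|];
  rewrite ?mul0r //.
case/eqP: ne_l; rewrite -[LHS]enum_valK; congr enum_rank; apply: val_inj => /=.
by rewrite t o; apply: surjective_pairing.
Qed.

Lemma shift_mxK : S *m S = 1%:M.
Proof.
apply/matrixP=> i j; rewrite shift_mulmx !mxE enum_rankK /origin /terminus /=.
by rewrite andbC -(inj_eq enum_val_inj) -val_eqE.
Qed.

Lemma adjoint_shift_mx : adjoint_mx S = S.
Proof.
by apply/matrixP=> i j; rewrite !mxE conjC_nat eq_sym andbC [X in X && _]eq_sym.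
Qed.

(** In the double sum over vertices, the Kronecker deltas of the boundary matrix collapse one index
    at a time. *)
Lemma sum_arc (F : V -> V -> C) :
  \sum_(j < #|arc e|) F (origin (enum_val j)) (terminus (enum_val j)) =
  \sum_x \sum_(y | e x y) F x y.
Proof.
rewrite -(big_enum_val (fun a : arc e => F (origin a) (terminus a))) /=.
rewrite pair_big_dep /= -(big_sub [pred p | e p.1 p.2] (fun p => F p.1 p.2)).
by [].
Qed.

Lemma sum_neighbours x (c : C) : \sum_(y | e x y) c = c *+ degree e x.
Proof. by rewrite sumr_const /degree cardsE. Qed.

Lemma conj_inv_sqrt_nat k : (((sqrtC k%:R)^-1)^* : C) = (sqrtC k%:R)^-1.
Proof. by apply: geC0_conj; rewrite invr_ge0 sqrtC_ge0 ler0n. Qed.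

Lemma inv_sqrtM_nat k : (sqrtC k%:R)^-1 * (sqrtC k%:R)^-1 = k%:R^-1 :> C.
Proof. by rewrite -invfM -expr2 sqrtCK. Qed.

(** The rows are orthonormal: row [x] is supported on the [degree e x] arcs ending at [x], with
    constant entries, and an arc has only one terminus. *)
Lemma boundary_mxK : d *m dh = 1%:M.
Proof.
apply/matrixP=> i j; rewrite mxE.
under eq_bigr do rewrite !mxE rmorphM /= conj_inv_sqrt_nat conjC_nat.
rewrite (sum_arc (fun _ y => (sqrtC (degree e (enum_val i))%:R)^-1 *
  (enum_val i == y)%:R * ((sqrtC (degree e (enum_val j))%:R)^-1 *
  (enum_val j == y)%:R))) mxE (exchange_big_dep predT) //=.
rewrite (bigD1 (enum_val i)) //= [X in _ + X]big1 ?addr0 => [|y /negPf];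
  last first.
  by rewrite eq_sym => ->; rewrite big1 // => *; rewrite mulr0 mul0r.
(* The sum runs over origins of arcs into the vertex; symmetry makes it a sum over neighbours,
   counted by the degree. *)
under eq_bigl do rewrite sym_e.
rewrite sum_neighbours eqxx mulr1 (inj_eq enum_val_inj) eq_sym.
have [<-|_] := eqVneq i j; last by rewrite !mulr0 mul0rn.
rewrite mulr1 inv_sqrtM_nat -[LHS]mulr_natr mulVf //.
by rewrite pnatr_eq0 -lt0n.
Qed.

Definition adjacency_mx : 'M[C]_#|V| :=
  \matrix_(i, j) (e (enum_val i) (enum_val j))%:R.

(** An arc contributes to entry [i], [j] only if it ends at [i] and its inverse ends at [j]. There
    is at most one such arc, and its weight is the square of [(sqrtC k%:R)^-1]. *)
Lemma discriminant_regular k : (forall x, degree e x = k) ->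
  d *m S *m dh = k%:R^-1 *: adjacency_mx.
Proof.
move=> reg; apply/matrixP=> i j; rewrite -mulmxA mxE.
under eq_bigr => l _.
  rewrite shift_mulmx !mxE rmorphM /= conj_inv_sqrt_nat conjC_nat.
  rewrite enum_rankK !reg.
  rewrite [terminus (arc_rev _)]/terminus /=.
over.
rewrite (sum_arc (fun x y => (sqrtC k%:R)^-1 *
  (enum_val i == y)%:R * ((sqrtC k%:R)^-1 * (enum_val j == x)%:R))) !mxE.
rewrite (bigD1 (enum_val j)) //= [X in _ + X]big1 ?addr0 => [|x /negPf];
  last first.
  by rewrite eq_sym => ->; rewrite big1 // => *; rewrite !mulr0.
rewrite big_mkcond (bigD1 (enum_val i)) //= [X in _ + X]big1 ?addr0
  => [|x /negPf].
  by rewrite sym_e; case: ifP; rewrite ?mulr0 // !eqxx !mulr1 inv_sqrtM_nat.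
by rewrite eq_sym => ->; rewrite mulr0 mul0r if_same.
Qed.

Lemma boundary_mul_coin : d *m (2%:R *: (dh *m d) - 1%:M) = d.
Proof.
by rewrite mulmxBr -scalemxAr mulmxA boundary_mxK mul1mx mulmx1 scaler_nat
  addrK.
Qed.

Lemma evolution_unitary : adjoint_mx U *m U = 1%:M.
Proof.
rewrite /evolution_mx adjoint_mxM adjoint_shift_mx mulmxA -[_ *m S *m S]mulmxA.
rewrite shift_mxK mulmx1 adjoint_mxB adjoint_mx1 adjoint_mxZ_nat adjoint_mxM.
rewrite adjoint_mxK mulmxBl -scalemxAl -mulmxA boundary_mul_coin mul1mx.
by rewrite opprB addrCA subrr addr0.
Qed.

Lemma evolution_exp_isometry n p (v : 'M[C]_(_, p)) :
  adjoint_mx (U ^+ n *m v) *m (U ^+ n *m v) = adjoint_mx v *m v.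
Proof.
elim: n => [|n IHn]; first by rewrite expr0 mul1mx.
rewrite exprS -mulmxE -(mulmxA U) (adjoint_mxM U) mulmxA.
by rewrite -(mulmxA _ (adjoint_mx U)) evolution_unitary mulmx1.
Qed.

(** The compression of [U ^+ n] to the vertex states: its entries are the inner products of evolved
    vertex states with vertex states. *)
Definition walk_mx n : 'M[C]_#|V| := d *m U ^+ n *m dh.

Lemma walk_mx0 : walk_mx 0 = 1%:M.
Proof. by rewrite /walk_mx expr0 mulmx1 boundary_mxK. Qed.

Lemma walk_mx1 : walk_mx 1 = d *m S *m dh.
Proof.
rewrite /walk_mx expr1 /evolution_mx -!mulmxA mulmxBl mul1mx -scalemxAl -mulmxA.
by rewrite boundary_mxK mulmx1 scaler_nat addrK mulmxA.
Qed.

(** Expanding the leftmost [U] of [U ^+ n.+2] leaves the term [d *m S *m U ^+ n.+1]. There [S]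
    cancels the shift of the next [U], and [d] absorbs its coin, so that [d *m U ^+ n] remains. *)
Lemma walk_mxSS n :
  walk_mx n.+2 = 2%:R *: (d *m S *m dh *m walk_mx n.+1) - walk_mx n.
Proof.
have dU (A : 'M[C]_#|arc e|) : d *m (U * A) =
    2%:R *: (d *m S *m dh *m (d *m A)) - d *m S *m A.
  rewrite -mulmxE /evolution_mx !mulmxA mulmxBr mulmx1 mulmxBl.
  by rewrite -scalemxAr -scalemxAl !mulmxA.
rewrite /walk_mx exprS dU mulmxBl -scalemxAl !mulmxA; congr (_ - _ *m _).
rewrite exprS -mulmxE /evolution_mx !mulmxA -(mulmxA d) shift_mxK mulmx1.
by rewrite boundary_mul_coin.
Qed.

Lemma vertex_state_unit x : unit_vector (vertex_state C e x).
Proof.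
apply/unit_vectorP; rewrite /vertex_state adjoint_mxM adjoint_mxK mulmxA.
rewrite -(mulmxA _ d) boundary_mxK mulmx1 adjoint_mx_delta mul_delta_mx.
by apply/matrixP=> i j; rewrite !ord1 !mxE.
Qed.

Lemma boundary_vertex_state x :
  d *m vertex_state C e x = delta_mx (enum_rank x) 0.
Proof. by rewrite mulmxA boundary_mxK mul1mx. Qed.

Lemma walk_of_evolution x y g n :
  U ^+ n *m vertex_state C e x = g *: vertex_state C e y ->
  walk_mx n *m delta_mx (enum_rank x) 0 =
  g *: (delta_mx (enum_rank y) 0 : 'cV[C]__).
Proof.
rewrite /walk_mx -mulmxA -/(vertex_state C e x) -mulmxA => ->.
by rewrite -scalemxAr boundary_vertex_state.
Qed.

(* Equality case of Cauchy-Schwarz: both [U ^+ n d^* e_x] and [d^* e_y] are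
   unit vectors, and their inner product is an entry of [walk_mx n]. *)
Lemma evolution_of_walk x y n :
  walk_mx n *m delta_mx (enum_rank x) 0 =
    delta_mx (enum_rank y) 0 :> 'cV[C]__ ->
  U ^+ n *m vertex_state C e x = vertex_state C e y.
Proof.
move=> walk; set v := U ^+ n *m _; set w := vertex_state C e y.
have vv : adjoint_mx v *m v = 1%:M.
  by rewrite evolution_exp_isometry; apply/unit_vectorP/vertex_state_unit.
have ww : adjoint_mx w *m w = 1%:M by apply/unit_vectorP/vertex_state_unit.
have dv : d *m v = delta_mx (enum_rank y) 0 by rewrite -walk /walk_mx !mulmxA.
have wv : adjoint_mx w *m v = 1%:M.
  rewrite adjoint_mxM adjoint_mxK -mulmxA dv adjoint_mx_delta mul_delta_mx.
  by apply/matrixP=> i j; rewrite !ord1 !mxE.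
have vw : adjoint_mx v *m w = 1%:M.
  by rewrite -[LHS]adjoint_mxK adjoint_mxM adjoint_mxK wv adjoint_mx1.
(* All four inner products of [v] and [w] are 1, so [v - w] has norm zero. *)
apply/eqP; rewrite -subr_eq0; apply/eqP/adjoint_mulmx_eq0.
by rewrite adjoint_mxB mulmxBl !mulmxBr vv ww wv vw !subrr.
Qed.

End GroverWalkSpectrum.

(** * Chebyshev values at rational points *)

Section Chebyshev.
Variable F : numFieldType.

(* [chebyshev x n] is the value at [x] of the first-kind polynomial [T_n]. *)
Fixpoint chebyshev (x : F) n :=
  if n is m.+1 then
    if m is l.+1 then 2%:R * x * chebyshev x m - chebyshev x l else x
  else 1.

Lemma chebyshev1 n : chebyshev 1 n = 1.
Proof.
suff [] : chebyshev 1 n = 1 /\ chebyshev 1 n.+1 = 1 by [].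
elim: n => // n [IH1 IH2]; split=> //.
by rewrite [LHS]/= -/(chebyshev 1 n.+1) IH1 IH2; ring.
Qed.

(* The polynomial [2 T_n (x / 2)] is monic with integer coefficients. *)
Lemma chebyshev_ratio (a b : int) (x : F) n :
  2%:R * x * b%:~R = a%:~R ->
  exists z : int, 2%:R * b%:~R ^+ n.+1 * chebyshev x n.+1 =
                  (a ^+ n.+1 + b * z)%:~R.
Proof.
move=> xE.
(* The recurrence looks back two indices, so the induction also carries the integer [w] of the
   preceding one. *)
suff [_ [z [_ E]]] : exists w z : int,
  2%:R * b%:~R ^+ n * chebyshev x n = w%:~R /\
  2%:R * b%:~R ^+ n.+1 * chebyshev x n.+1 = (a ^+ n.+1 + b * z)%:~R
  by exists z.
elim: n => [|n [w [z [IH1 IH2]]]].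
  by exists 2, 0; split; rewrite /= ?mulr0 ?addr0 ?expr1 -?xE; ring.
(* The new witness comes from a(a^(n+1) + bz) - b^2 w, which is the recurrence multiplied by 2
   b^(n+2) with 2xb = a. *)
exists (a ^+ n.+1 + b * z), (a * z - b * w); split=> //.
transitivity (a%:~R * (a ^+ n.+1 + b * z)%:~R - b%:~R ^+ 2 * w%:~R : F).
  by rewrite -IH1 -IH2 -xE /= !exprS; ring.
by rewrite !exprS; ring.
Qed.

(* [- 4 / k] is a rational root of the monic integer polynomial
   [2 T_n (x / 2) - 2], hence an integer. *)
Lemma chebyshev_eq1_dvd (k n : nat) :
  (0 < k)%N -> (0 < n)%N -> chebyshev (- 2%:R / k%:R) n = 1 -> (k %| 4)%N.
Proof.
move=> k_gt0; case: n => // n _ cheb1; set g := gcdn 4 k.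
have g_gt0 : (0 < g)%N by rewrite gcdn_gt0.
have [g4 gk] : (g %| 4)%N /\ (g %| k)%N by rewrite dvdn_gcdl dvdn_gcdr.
(* The fraction a / b is 4 / k in lowest terms; the aim is b = 1, which makes k equal to the gcd. *)
have [a def4] := dvdnP g4; have [b defk] := dvdnP gk.
have co_ab : coprime a b.
  by rewrite /coprime -(eqn_pmul2r g_gt0) muln_gcdl -def4 -defk mul1n.
have := chebyshev_ratio (a := - a%:Z) (b := b%:Z) (x := - 2%:R / k%:R) n.
have g0 : (g%:R : F) != 0 by rewrite pnatr_eq0 -lt0n.
have k0 : (k%:R : F) != 0 by rewrite pnatr_eq0 -lt0n.
case.
  have ag : a%:R * g%:R = 4%:R :> F by rewrite -natrM -def4.
  have bg : b%:R * g%:R = k%:R :> F by rewrite -natrM -defk.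
  apply: (mulIf g0); rewrite mulrNz -!pmulrn [RHS]mulNr ag.
  by rewrite -[LHS]mulrA bg; field.
move=> z; rewrite cheb1 mulr1.
have -> : 2%:R * (b%:Z)%:~R ^+ n.+1 = (2%:Z * b%:Z ^+ n.+1)%:~R :> F.
  by rewrite rmorphM rmorphXn.
move/intr_inj => E.
have : (b%:Z %| (- a%:Z) ^+ n.+1)%Z.
  have -> : (- a%:Z) ^+ n.+1 = b%:Z * (2%:Z * b%:Z ^+ n - z).
    by rewrite mulrBr mulrCA -exprS E addrK.
  exact: dvdz_mulr.
rewrite dvdzE abszX abszN /= => dvd_b.
have b1 : b = 1%N.
  apply/eqP; rewrite -dvdn1 -(Gauss_dvdr (m := b) (n := a ^ n.+1) 1).
    by rewrite muln1.
  by rewrite coprimeXr // coprime_sym.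
by rewrite defk b1 mul1n.
Qed.

End Chebyshev.

(** * Walk matrices of regular and strongly regular graphs *)

Section RegularWalk.
Variables (C : numClosedFieldType) (V : finType) (e : rel V) (k : nat).
Hypotheses (sym_e : symmetric e) (irr_e : irreflexive e).
Hypotheses (reg_e : forall x, degree e x = k) (k_gt0 : (0 < k)%N).

Local Notation A := (adjacency_mx C e).
Local Notation X := (walk_mx C e).
Local Notation vec x := (delta_mx (enum_rank x) 0 : 'cV[C]_#|V|).

Let deg_gt0 x : (0 < degree e x)%N. Proof. by rewrite reg_e. Qed.

Let k_neq0 : (k%:R : C) != 0. Proof. by rewrite pnatr_eq0 -lt0n. Qed.

Lemma regular_walk1 : X 1 = k%:R^-1 *: A.
Proof. by rewrite walk_mx1 // (discriminant_regular C sym_e reg_e). Qed.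

Lemma regular_walkSS n : X n.+2 = (2%:R / k%:R) *: (A *m X n.+1) - X n.
Proof.
by rewrite walk_mxSS // (discriminant_regular C sym_e reg_e) -scalemxAl scalerA.
Qed.

(** On a left eigenvector of A / k the matrix recurrence becomes the scalar Chebyshev recurrence. *)
Lemma walk_left_eigen (v : 'rV[C]_#|V|) (t : C) n :
  v *m A = (k%:R * t) *: v -> v *m X n = chebyshev t n *: v.
Proof.
move=> vA; suff [] : v *m X n = chebyshev t n *: v /\
  v *m X n.+1 = chebyshev t n.+1 *: v by [].
elim: n => [|n [IH1 IH2]].
  rewrite walk_mx0 // mulmx1 scale1r regular_walk1; split=> //.
  by rewrite -scalemxAr vA scalerA mulKf.
split=> //; rewrite regular_walkSS mulmxBr IH1 -scalemxAr mulmxA vA -scalemxAl.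
rewrite IH2 !scalerA -scalerBl; congr (_ *: _) => /=.
by rewrite -/(chebyshev t n.+1); field.
Qed.

Lemma vec_coef x z : vec x (enum_rank z) 0 = (z == x)%:R.
Proof. by rewrite mxE eqxx andbT (inj_eq enum_rank_inj). Qed.

Lemma mulmx_vec p (B : 'M[C]_(p, _)) x i : (B *m vec x) i 0 = B i (enum_rank x).
Proof. by rewrite -colE mxE. Qed.

Lemma adjacency_coef x y : A (enum_rank x) (enum_rank y) = (e x y)%:R.
Proof. by rewrite mxE !enum_rankK. Qed.

Lemma adjacency_const : A *m (const_mx 1 : 'M_#|V|) = k%:R *: const_mx 1.
Proof.
apply/matrixP=> i j; rewrite !mxE mulr1 -(reg_e (enum_val i)) /degree.
rewrite -sum1_card natr_sum [RHS]big_mkcond [RHS](reindex (@enum_val _ V)) /=.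
  by apply: eq_bigr => l _; rewrite !mxE mulr1 inE; case: (e _ _).
by exists enum_rank => ? _; rewrite ?enum_valK ?enum_rankK.
Qed.

Lemma const_adjacency : const_mx 1 *m A = k%:R *: (const_mx 1 : 'rV_#|V|).
Proof.
have AT : A^T = A by apply/matrixP=> i j; rewrite !mxE sym_e.
rewrite -[LHS]trmxK trmx_mul AT trmx_const; apply/matrixP=> i j.
have := congr1 (fun B : 'M_#|V| => B j j) adjacency_const.
by rewrite !mxE => <-; apply: eq_bigr => l _; rewrite !mxE.
Qed.

(** For a strongly regular graph these matrices form the Bose-Mesner algebra, here written in the
    spanning set I, A, J. *)
Definition scheme_mx (a b c : C) : 'M[C]_#|V| :=
  a *: 1%:M + b *: A + c *: const_mx 1.

Lemma scheme_coef a b c x y :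
  scheme_mx a b c (enum_rank x) (enum_rank y) =
  a * (x == y)%:R + b * (e x y)%:R + c.
Proof.
by rewrite !mxE !enum_rankK (inj_eq enum_rank_inj) mulr1.
Qed.

Section Scheme.
Variables p q r : C.
Hypothesis A2 : A *m A = scheme_mx p q r.

Lemma adjacency_scheme a b c :
  A *m scheme_mx a b c =
  scheme_mx (b * p) (a + b * q) (b * r + c * k%:R).
Proof.
rewrite !mulmxDr -!scalemxAr mulmx1 A2 adjacency_const.
by apply/matrixP=> i j; rewrite !mxE; ring.
Qed.

(** The coefficients are kept explicit so that the recurrence can later be iterated by
    computation. *)
Lemma walk_schemeSS n a b c a' b' c' :
  X n = scheme_mx a b c -> X n.+1 = scheme_mx a' b' c' ->
  X n.+2 = scheme_mx (2%:R / k%:R * (b' * p) - a)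
                     (2%:R / k%:R * (a' + b' * q) - b)
                     (2%:R / k%:R * (b' * r + c' * k%:R) - c).
Proof.
move=> Xn Xn1; rewrite regular_walkSS Xn Xn1 adjacency_scheme.
by apply/matrixP=> i j; rewrite !mxE; ring.
Qed.

Lemma walk_scheme0 : X 0 = scheme_mx 1 0 0.
Proof. by rewrite walk_mx0 // /scheme_mx scale1r !scale0r !addr0. Qed.

Lemma walk_scheme1 : X 1 = scheme_mx 0 k%:R^-1 0.
Proof. by rewrite regular_walk1 /scheme_mx !scale0r add0r addr0. Qed.

Lemma walk_scheme n : exists a b c, X n = scheme_mx a b c.
Proof.
suff [[a [b [c ->]]] _] : (exists a b c, X n = scheme_mx a b c) /\
  (exists a b c, X n.+1 = scheme_mx a b c) by exists a, b, c.
elim: n => [|n [[a [b [c IH1]]] [a' [b' [c' IH2]]]]].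
  split; first by exists 1, 0, 0; exact: walk_scheme0.
  by exists 0, k%:R^-1, 0; exact: walk_scheme1.
by split; [exists a', b', c' | do 3!eexists; exact: (walk_schemeSS IH1 IH2)].
Qed.

End Scheme.

(** Entries of A^2 count common neighbours: k on the diagonal, l on edges, m elsewhere. Taking m J
    out leaves the differences with m as the other coefficients. *)
Lemma srg_adjacency_sqr n l m : srg e n k l m ->
  A *m A = scheme_mx (k%:R - m%:R) (l%:R - m%:R) m%:R.
Proof.
case=> _ [_ adj nadj]; apply/matrixP=> i j.
rewrite -(enum_valK i) -(enum_valK j) scheme_coef mxE.
set x := enum_val i; set y := enum_val j.
have -> : \sum_l0 A (enum_rank x) l0 * A l0 (enum_rank y) =
  #|common_neighbours e x y|%:R.
  rewrite -sum1_card natr_sum [RHS]big_mkcond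
    [RHS](reindex (@enum_val _ V)) /=; last first.
    by exists enum_rank => ? _; rewrite ?enum_valK ?enum_rankK.
  apply: eq_bigr => h _; rewrite !mxE !enum_rankK inE (sym_e y) -natrM mulnb.
  by case: (_ && _).
have [<-|ne_xy] := eqVneq x y.
  rewrite irr_e (_ : #|_| = k); first by rewrite mulr1 mulr0 addr0 subrK.
  rewrite -(reg_e x) /degree; congr #|pred_of_set _|.
  by apply/setP=> z; rewrite !inE andbb.
have [exy | nexy] := boolP (e x y).
  by rewrite adj // mulr0 mulr1 add0r subrK.
by rewrite nadj // !mulr0 !add0r.
Qed.

End RegularWalk.

(** * The complete multipartite graph with parts of size two *)

Section DoubledParts.
Variable m : nat.
Local Notation W := (multipartite_vertex (nseq m 2%N)).

Lemma part_size (i : 'I_(size (nseq m 2%N))) : nth 0%N (nseq m 2%N) i = 2%N.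
Proof. by rewrite nth_nseq; have := ltn_ord i; rewrite {2}size_nseq => ->. Qed.

Lemma card_doubled_parts : #|W| = (m * 2)%N.
Proof.
rewrite card_tagged sumnE big_map big_enum /=.
under eq_bigr => i _ do rewrite card_ord part_size.
by rewrite sum_nat_const card_ord size_nseq.
Qed.

(** The antipode keeps the part and exchanges its two elements by [rev_ord]. *)
Lemma doubled_parts_antipode : exists t : W -> W, forall u,
  t u != u /\ forall v, @complete_multipartite _ u v = (v != u) && (v != t u).
Proof.
pose part (i : 'I_(size (nseq m 2%N))) := 'I_(nth 0%N (nseq m 2%N) i).
exists (fun u => Tagged part (rev_ord (tagged u))).
case=> i j.
have rev_ne (j1 j2 : 'I_(nth 0%N (nseq m 2%N) i)) :
    (j2 != j1) = (j2 == rev_ord j1).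
  rewrite -!val_eqE /=; move: (ltn_ord j1) (ltn_ord j2).
  move: (nat_of_ord j1) (nat_of_ord j2); rewrite part_size.
  by move=> [|[|//]] [|[|//]].
split; first by rewrite eq_Tagged /= rev_ne.
case=> i' j'; rewrite /complete_multipartite /=.
have [eq_i | ne_i] := eqVneq i i'.
  move: j'; rewrite -{i'}eq_i => j'.
  by rewrite !eq_Tagged /= rev_ne andbN.
by rewrite -!tag_eqE /tag_eq /= eq_sym (negPf ne_i).
Qed.

End DoubledParts.

(** * Graphs in which every vertex has one antipode *)

Section AntipodalGraph.
Variables (V : finType) (e : rel V).
Hypotheses (sym_e : symmetric e) (irr_e : irreflexive e).

(** For symmetric [e] this is the cocktail party graph: its complement is the perfect matching that
    pairs [x] with [s x]. *)
Definition antipodal (s : V -> V) : Prop :=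
  (forall x, s x != x) /\ (forall x y, e x y = (y != x) && (y != s x)).

(** By symmetry [s x] is not adjacent to [x]; as [x] differs from [s x], it can only be the antipode
    of [s x]. *)
Lemma antipodalK s : antipodal s -> involutive s.
Proof.
case=> s_ne eE x; have := sym_e (s x) x.
rewrite [in RHS]eE eqxx andbF eE eq_sym s_ne /=.
by move/negbFE/eqP.
Qed.

Lemma antipodal_degree s x : antipodal s -> (degree e x + 2)%N = #|V|.
Proof.
case=> s_ne eE; rewrite -(cardsC [set x; s x]) cards2 eq_sym s_ne addnC.
by congr (_ + _)%N; apply: eq_card => y; rewrite !inE eE negb_or.
Qed.

Lemma antipodal_of_degree :
  (forall x, (degree e x + 2)%N = #|V|) -> exists s, antipodal s.
Proof.
move=> deg; have anti x :
    exists y, y != x /\ forall z, e x z = (z != x) && (z != y).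
  (* The degree leaves exactly one vertex outside the closed neighbourhood of [x]. *)
  have /eqP/cards1P[y /setP yE] : #|~: (x |: [set y | e x y])| = 1%N.
    have := cardsC (x |: [set y | e x y]).
    rewrite -(deg x) cardsU1 inE irr_e -/(degree e x) [(_ + degree e x)%N]add1n.
    by rewrite addSnnS => /addnI[].
  have := yE y; rewrite !inE eqxx negb_or => /andP[ne_yx _].
  exists y; split=> // z; have := yE z; rewrite !inE negb_or.
  have [-> _|_ /=] := eqVneq z x; first by rewrite irr_e.
  by move/(congr1 negb); rewrite negbK.
have [s sP] := fin_all_exists anti.
by exists s; split=> [x|x z]; have [] := sP x.
Qed.

(** A clique meets each antipodal pair at most once, and the cardinality makes [xs] meet every pair.
    The pairs are then the parts. *)
Lemma antipodal_iso_multipartite s (x0 : V) (xs : seq V) :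
  antipodal s -> pairwise e xs -> #|V| = (size xs * 2)%N ->
  graph_iso e (@complete_multipartite (nseq (size xs) 2%N)).
Proof.
move=> s_anti /(pairwiseP x0) xs_e cardV; have [s_ne eE] := s_anti.
have sK := antipodalK s_anti.
set W := multipartite_vertex _; pose r i := nth x0 xs i.
(* Index 0 of a part goes to its clique vertex and index 1 to the antipode of that vertex. *)
pose g (u : W) := if val (tagged u) == 0%N then r (tag u) else s (r (tag u)).
have tag_lt (u : W) : (tag u < size xs)%N.
  by apply: leq_trans (ltn_ord _) _; rewrite size_nseq.
(* Antipodes are twins, so adjacency of images depends on the parts alone. *)
have e_s x y : e (s x) y = e x y by rewrite !eE sK andbC.
have e_g u v : e (g u) (g v) = e (r (tag u)) (r (tag v)).
  by rewrite /g; do 2!case: ifP => _; rewrite ?e_s // sym_e ?e_s sym_e ?e_s.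
have g_edge u v : e (g u) (g v) = @complete_multipartite _ u v.
  rewrite e_g /complete_multipartite -val_eqE /=.
  case: ltngtP => [lt_uv|lt_vu|->] /=; last by rewrite irr_e.
    by rewrite xs_e ?inE.
  by rewrite sym_e xs_e ?inE.
have lt2 (u : W) : (tagged u < 2)%N.
  by apply: leq_trans (ltn_ord _) _; rewrite nth_nseq; case: ifP.
have g_inj : injective g.
  (* Equal images are not adjacent, which forces equal parts; within a part, [s_ne] separates the
     two images. *)
  move=> u v guv; have := g_edge u v; rewrite guv irr_e => /esym/negbFE/eqP.
  move: guv (lt2 u) (lt2 v); rewrite /g.
  case: u v => [i j] [i' j'] /= guv lt_j lt_j' eq_i.
  move: j' lt_j' guv; rewrite -{i'}eq_i => j' lt_j' guv.
  suff -> : j = j' by [].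
  apply: val_inj; move: lt_j lt_j' guv => /=.
  case: (val j) (val j') => [|[|//]] [|[|//]] //= _ _ /eqP.
    by rewrite eq_sym (negPf (s_ne _)).
  by rewrite (negPf (s_ne _)).
have cardW : #|W| = #|V| by rewrite card_doubled_parts.
have [f gK fK] := inj_card_bij g_inj (eq_leq (esym cardW)).
exists f; first by exists g.
by move=> x y; rewrite -g_edge !fK.
Qed.

(** Pulled back along the isomorphism, the antipode shows that each vertex misses just itself and
    one other, so the degree criterion applies. *)
Lemma iso_multipartite_antipodal m :
  graph_iso e (@complete_multipartite (nseq m 2%N)) ->
  (exists s, antipodal s) /\ #|V| = (m * 2)%N.
Proof.
case=> f f_bij fE; split; last first.
  by rewrite (bij_eq_card f_bij) card_doubled_parts.
apply: antipodal_of_degree => x; have [g fK gK] := f_bij.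
have [t /(_ (f x)) [t_ne tE]] := doubled_parts_antipode m.
rewrite -(cardsC [set x; g (t (f x))]) cards2 addnC.
rewrite -(inj_eq (can_inj fK)) gK eq_sym t_ne.
congr (_ + _)%N; apply: eq_card => y; rewrite !inE -fE tE negb_or.
by rewrite -!(inj_eq (can_inj fK)) gK.
Qed.

End AntipodalGraph.

(** * Constraints on transfer in regular graphs *)

Section RegularTransfer.
Variables (C : numClosedFieldType) (V : finType) (e : rel V) (k : nat).
Hypotheses (sym_e : symmetric e) (irr_e : irreflexive e).
Hypotheses (reg_e : forall x, degree e x = k) (k_gt0 : (0 < k)%N).

Local Notation A := (adjacency_mx C e).
Local Notation X := (walk_mx C e).
Local Notation vec x := (delta_mx (enum_rank x) 0 : 'cV[C]_#|V|).
Local Notation covec x := (delta_mx 0 (enum_rank x) : 'rV[C]_#|V|).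

Let deg_gt0 x : (0 < degree e x)%N. Proof. by rewrite reg_e. Qed.

Lemma pst_of_walk x y tau : x != y -> (0 < tau)%N ->
  X tau *m vec x = vec y -> admits_pst C e.
Proof.
move=> ne_xy tau_gt0 walk; exists x, y; split=> //; exists tau; split=> //.
- exact: vertex_state_unit.
- exact: vertex_state_unit.
(* Applying [d] recovers the basis vectors from the vertex states, and these differ. *)
- move/(congr1 (mulmx (boundary_mx C e))); rewrite !boundary_vertex_state //.
  move/matrixP/(_ (enum_rank x) 0); rewrite !vec_coef eqxx (negPf ne_xy).
  by apply/eqP; rewrite oner_eq0.
- by exists 1; rewrite ?normr1 // scale1r; apply: evolution_of_walk.
Qed.

(** Column [x] of the walk matrix is constant on the neighbours of [x] and on its other
    non-neighbours. Being supported at [y], it makes the class of [y] a singleton. *)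
Lemma srg_transfer_nonneighbour n l m x y tau g :
  srg e n k l m -> connected_graph e -> x != y -> g != 0 ->
  X tau *m vec x = g *: vec y ->
  forall z, (z != x) && ~~ e x z = (z == y).
Proof.
move=> srg_e conn_e ne_xy g_neq0 walk.
have A2 := srg_adjacency_sqr C sym_e irr_e reg_e srg_e.
have [a [b [c Xtau]]] := walk_scheme sym_e reg_e k_gt0 A2 tau.
have coef z : a * (z == x)%:R + b * (e x z)%:R + c = g * (z == y)%:R.
  have := congr1 (fun v : 'cV_#|V| => v (enum_rank z) 0) walk.
  by rewrite mulmx_vec Xtau scheme_coef mxE vec_coef sym_e.
have [exy | nexy] := boolP (e x y); last first.
  have cE : c = g.
    have := coef y; rewrite eqxx eq_sym (negPf ne_xy) (negPf nexy).
    by rewrite !mulr0 !add0r mulr1.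
  move=> z; have [-> | ne_zx] := eqVneq z x; first by rewrite (negPf ne_xy).
  have := coef z; rewrite (negPf ne_zx) mulr0 add0r cE /=.
  have [exz _ | nexz] := boolP (e x z).
    by apply/esym/negP => /eqP zy; rewrite -zy exz in nexy.
  rewrite mulr0 add0r; case: (z == y) => // /eqP.
  by rewrite mulr0 (negPf g_neq0).
(* A neighbour [y] would be the only one, so that [e] would be [K_2]. *)
have only_y z : e x z -> z = y.
  move=> exz; have ne_zx : z != x by apply: contraTneq exz => ->; rewrite irr_e.
  have := coef z; have := coef y.
  rewrite exy exz eqxx (eq_sym y) (negPf ne_xy) (negPf ne_zx) => ->.
  by have [//|_ /eqP] := eqVneq z y; rewrite mulr0 mulr1 (negPf g_neq0).
have k1 : k = 1%N.
  rewrite -(reg_e x) /degree (_ : [set z | e x z] = [set y]) ?cards1 //.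
  by apply/setP=> z; rewrite !inE; apply/idP/eqP => [/only_y|->].
have only_x z : e y z -> z = x.
  move=> eyz; have /eqP/cards1P[w /setP wE] : #|[set t | e y t]| = 1%N.
    by rewrite -k1 -(reg_e y).
  have := wE z; have := wE x; rewrite !inE (sym_e y) exy eyz.
  by move=> /esym/eqP -> /esym/eqP ->.
(* By connectedness a closed set containing [x] is all of [V], which would make the graph
   complete. *)
have cl : closed e [set x; y].
  move=> u v euv; rewrite !inE; apply/idP/idP => /orP[] /eqP uE;
    rewrite uE in euv.
  - by rewrite (only_y _ euv) eqxx orbT.
  - by rewrite (only_x _ euv) eqxx.
  - by rewrite sym_e in euv; rewrite (only_y _ euv) eqxx orbT.
  - by rewrite sym_e in euv; rewrite (only_x _ euv) eqxx.
case: srg_e => [[_ ncomp _] _]; case: ncomp => u v.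
have all_xy w : (w == x) || (w == y).
  by have := closed_connect cl (conn_e x w); rewrite !inE eqxx => /esym.
case/orP: (all_xy u) => /eqP ->; case/orP: (all_xy v) => /eqP ->;
  rewrite ?eqxx //.
by rewrite sym_e.
Qed.

Variable s : V -> V.
Hypothesis s_anti : antipodal e s.

Lemma antipodal_covec x : covec x *m A = const_mx 1 - covec x - covec (s x).
Proof.
apply/matrixP=> i j; rewrite ord1 -rowE -(enum_valK j).
rewrite [LHS]mxE adjacency_coef ![in RHS]mxE !eqxx !(inj_eq enum_rank_inj) /=.
have [s_ne eE] := s_anti; rewrite eE; have [-> | _] := eqVneq (enum_val j) x.
  by rewrite eq_sym (negPf (s_ne x)) subrr subr0.
by rewrite subr0; case: eqP => _; rewrite ?subrr ?subr0.
Qed.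

(** Write r for row [x] of A, the all-ones row minus the covectors of [x] and [s x]. Both [x] and
    [s x] have row r, so r A is k times the all-ones row minus 2 r. *)
Lemma antipodal_adjacency_sqr : A *m A = scheme_mx e 0 (- 2%:R) k%:R.
Proof.
apply/row_matrixP=> i; rewrite !rowE -(enum_valK i) mulmxA.
rewrite !antipodal_covec !mulmxBl !antipodal_covec (antipodalK sym_e s_anti).
rewrite (const_adjacency C sym_e reg_e) /scheme_mx scale0r add0r mulmxDr.
rewrite -!scalemxAr antipodal_covec.
have -> : covec (enum_val i) *m (const_mx 1 : 'M_#|V|) = const_mx 1.
  apply/matrixP=> a b; rewrite mxE (bigD1 (enum_rank (enum_val i))) //= big1.
    by rewrite !mxE ord1 !eqxx mulr1 addr0.
  by move=> t /negPf ne_t; rewrite !mxE ne_t andbF mul0r.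
by apply/matrixP=> a b; rewrite !mxE; ring.
Qed.

Lemma antipodal_transfer_dvd x tau g : (0 < tau)%N ->
  X tau *m vec x = g *: vec (s x) -> (k %| 4)%N.
Proof.
move=> tau_gt0 walk; have [s_ne eE] := s_anti.
have k_neq0 : k%:R != 0 :> C by rewrite pnatr_eq0 -lt0n.
(* Pairing the transfer equation with a left eigenvector compares its entries at [x] and [s x]. *)
have pair_coef (v : 'rV[C]_#|V|) t :
  v *m A = (k%:R * t) *: v ->
    chebyshev t tau * v 0 (enum_rank x) = g * v 0 (enum_rank (s x)).
  move/(walk_left_eigen sym_e reg_e k_gt0 tau) => vX.
  have := congr1 (mulmx v) walk; rewrite mulmxA vX -scalemxAl -scalemxAr.
  move/(congr1 (fun B : 'M_1 => B 0 0)).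
  by rewrite [LHS]mxE [RHS]mxE !mulmx_vec.
(* The constant covector has eigenvalue [k], which pins the phase to [1]. *)
have g1 : g = 1.
  have := pair_coef (const_mx 1) 1; rewrite mulr1 chebyshev1 !mxE !mulr1.
  move=> <- //.
  exact: const_adjacency.
have [z exz] : exists z, e x z.
  have : (0 < degree e x)%N by rewrite reg_e.
  by rewrite /degree card_gt0 => /set0Pn[z]; rewrite inE; exists z.
(* A difference of two antipodal pairs has eigenvalue [- 2]. *)
pose v : 'rV[C]_#|V| := covec x + covec (s x) - covec z - covec (s z).
have sK := antipodalK sym_e s_anti.
apply: (@chebyshev_eq1_dvd C k tau) => //.
have := pair_coef v (- 2%:R / k%:R).
(* Since [z] is adjacent to [x] and to [s x], the two pairs are disjoint and [v] equals 1 at both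
   [x] and [s x]. *)
have vcoef w : e z w -> (w == x) || (w == s x) -> v 0 (enum_rank w) = 1.
  rewrite eE => /andP[/negPf w_z /negPf w_sz] w_x.
  rewrite ![in LHS]mxE !eqxx !(inj_eq enum_rank_inj) /= w_z w_sz !subr0 -natrD.
  by case/orP: w_x => /eqP ->; rewrite eqxx ?(negPf (s_ne x)) //;
    rewrite eq_sym (negPf (s_ne x)).
rewrite (vcoef x) ?eqxx // 1?sym_e // (vcoef (s x)) ?eqxx ?orbT //; last first.
  by rewrite sym_e eE sK andbC -eE.
rewrite g1 !mulr1.
apply; rewrite mulrC divfK // /v !mulmxBl mulmxDl !antipodal_covec !sK.
by apply/matrixP=> i j; rewrite !mxE; ring.
Qed.

End RegularTransfer.

(** * Transfer for degrees two and four, and the characterisation *)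

Lemma antipodal_transfer (C : numClosedFieldType) (V : finType) (e : rel V)
    k s (x : V) :
  symmetric e -> antipodal e s -> (forall y, degree e y = k) ->
  k = 2%N \/ k = 4%N ->
  admits_pst C e.
Proof.
move=> sym_e s_anti reg_e k24.
have k_gt0 : (0 < k)%N by case: k24 => ->.
have A2 := antipodal_adjacency_sqr C sym_e reg_e s_anti.
have X0 := walk_scheme0 C sym_e reg_e k_gt0.
have X1 := walk_scheme1 C sym_e reg_e k_gt0.
have step := walk_schemeSS sym_e reg_e k_gt0 A2.
have [s_ne eE] := s_anti.
have transfer tau : (0 < tau)%N ->
  walk_mx C e tau = scheme_mx e (- 1) (- 1) 1 ->
  admits_pst C e.
  move=> tau_gt0 Xtau.
  apply: (pst_of_walk sym_e reg_e k_gt0 (x := x) (y := s x) _ tau_gt0).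
    by rewrite eq_sym.
  apply/matrixP=> i j; rewrite ord1 mulmx_vec Xtau -(enum_valK i).
  rewrite scheme_coef vec_coef sym_e eE; have [-> | _] := eqVneq (enum_val i) x.
    by rewrite eq_sym (negPf (s_ne x)) /=; ring.
  by case: (_ == s x) => /=; ring.
(* On the eigenvalues 1, 0, -2/k of A / k the target J - 1 - A takes the values 1, -1, 1. Now T_n(0)
   = -1 asks for n = 2 mod 4, and for k = 4 the condition T_n(-1/2) = 1 asks that 3 divide n: hence
   times 2 and 6. *)
case: k24 => k_def; rewrite k_def in X1 step.
  apply: (transfer 2%N) => //; rewrite (step _ _ _ _ _ _ _ X0 X1).
  by congr scheme_mx; field.
have X2 := step _ _ _ _ _ _ _ X0 X1; have X3 := step _ _ _ _ _ _ _ X1 X2.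
have X4 := step _ _ _ _ _ _ _ X2 X3; have X5 := step _ _ _ _ _ _ _ X3 X4.
apply: (transfer 6%N) => //; rewrite (step _ _ _ _ _ _ _ X4 X5).
by congr scheme_mx; field.
Qed.

Theorem theorem3p6 (R : realType) (V : finType) (e : rel V)
    (hgraph : simple_graph e) (hconn : connected_graph e)
    (hsrg : strongly_regular e) :
  admits_pst (complex R) e <->
    graph_iso e (@complete_multipartite [:: 2; 2]) \/
    graph_iso e (@complete_multipartite [:: 2; 2; 2]).
Proof.
have [sym_e irr_e deg_gt0] := hgraph; have [n [k [l [m srg_e]]]] := hsrg.
have [[cardV _ not_edgeless] [reg_e _ _]] := srg_e.
have antipodal_k s : antipodal e s -> forall x : V, (k + 2)%N = #|V|.
  by move=> s_anti x; rewrite -(reg_e x) (antipodal_degree x s_anti).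
split=> [[x [y [ne_xy [tau [_ _ _ tau_gt0 [g g1 evol]]]]]] | iso].
  have k_gt0 : (0 < k)%N by rewrite -(reg_e x).
  have g_neq0 : g != 0 by rewrite -normr_eq0 g1 oner_eq0.
  have walk := walk_of_evolution sym_e deg_gt0 evol.
  have nonadj := srg_transfer_nonneighbour sym_e irr_e reg_e k_gt0 srg_e hconn
    ne_xy g_neq0 walk.
  (* The neighbours of [x] are all vertices but [x] and [y]; regularity carries the count k + 2 =
     |V| to every vertex. *)
  have [s s_anti] : exists s, antipodal e s.
    apply: antipodal_of_degree => // z; rewrite reg_e -(reg_e x).
    rewrite -(cardsC [set x; y]) cards2 ne_xy addnC; congr (_ + _)%N.
    apply: eq_card => w; rewrite !inE negb_or -nonadj negb_and negbK.
    by have [-> | _] := eqVneq w x; rewrite ?irr_e ?negbK.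
  have [s_ne eE] := s_anti; have sK := antipodalK sym_e s_anti.
  have y_def : y = s x.
    by apply/esym/eqP; rewrite -nonadj s_ne eE eqxx andbF.
  rewrite y_def in walk.
  have k4 := antipodal_transfer_dvd sym_e reg_e k_gt0 s_anti tau_gt0 walk.
  have cardk := antipodal_k s s_anti x.
  have [z exz] : exists z, e x z.
    by have := deg_gt0 x; rewrite card_gt0 => /set0Pn[z]; rewrite inE; exists z.
  have : k \in divisors 4 by rewrite -dvdn_divisors.
  rewrite !inE => /or3P[] /eqP k_def; rewrite k_def in cardk reg_e.
  (* Degree 1 is impossible: with [z], its antipode is a neighbour of [x] too. *)
  - have := reg_e x; rewrite /degree.
    have : [set z; s z] \subset [set w | e x w].
      apply/subsetP=> w; rewrite !inE => /orP[] /eqP -> //.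
      by rewrite sym_e eE sK andbC -eE sym_e.
    by move/subset_leq_card; rewrite cards2 eq_sym s_ne => /[swap] ->.
  - left; apply: (antipodal_iso_multipartite sym_e irr_e x (xs := [:: x; z])
      s_anti).
      by rewrite /= exz.
    by rewrite -cardk.
  - right.
    (* Four neighbours of [x] cannot all lie in one antipodal pair; any [w] outside completes a
       triangle with [x] and [z]. *)
    have /subsetPn[w] : ~~ ([set w | e x w] \subset [set z; s z]).
      apply/negP=> /subset_leq_card; rewrite -/(degree e x) reg_e cards2.
      by case: (_ != _).
    rewrite !inE negb_or => exw /andP[w_z w_sz].
    apply: (antipodal_iso_multipartite sym_e irr_e x (xs := [:: x; z; w])
      s_anti).
      by rewrite /= exz exw eE w_z w_sz.
    by rewrite -cardk.
(* A starting vertex exists because a graph without vertices is edgeless. *)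
have [x _ | V0] := pickP (@predT V); last first.
  by case: not_edgeless => x; have := V0 x.
have [s_anti cardV'] : (exists s, antipodal e s) /\ (#|V| = 4 \/ #|V| = 6)%N.
  by case: iso => [/(@iso_multipartite_antipodal _ _ irr_e 2) |
    /(@iso_multipartite_antipodal _ _ irr_e 3)] [s_anti cV];
    split=> //; [left | right].
have [s sP] := s_anti; apply: (antipodal_transfer _ x sym_e sP reg_e).
case: cardV' (antipodal_k s sP x) => -> /eqP;
  rewrite ?(eqn_add2r 2 k 2) ?(eqn_add2r 2 k 4) => /eqP k_def.
  by left.
by right.
Qed.
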